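(* Let $C\in\mathbb C^{N\times N}$ be the true covariance matrix with singular values $\lambda_1>\lambda_2>\cdots>\lambda_N\ge0$, let $C_\delta\in\mathbb C^{N\times N}$ be a Hermitian perturbation, and let $\tilde C=C+C_\delta$. Suppose that there exist an index $T\ge1$ and a constant $L>1$ such that $\frac{\lambda_i}{\lambda_{i+1}}>L$ for all $i>T$ (with $i<N$), and let $T<K<N$ with $\|C_\delta\|_2<\lambda_K$. Let $\hat\phi_K$ and $\tilde\phi_K$ be the truncated contrast source and the projection of the contrast source onto the perturbed subspace $\tilde{\mathcal S}_K$ (as defined in the context). Then $$\mathbb E\left[\|\hat\phi_K-\tilde\phi_K\|_2\right]\le\sqrt{\varepsilon_K}+C_1\lambda_K+C_2K\sqrt{\lambda_K},$$ where $C_1=\frac{2\sqrt{\varepsilon_0}}{\lambda_T-\lambda_{T+1}}$ and $C_2=\frac{2L}{L-1}$ are constants independent of $K$, and $\varepsilon_i=\sum_{n=i+1}^N\lambda_n$.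
   Context: $C\in\mathbb C^{N\times N}$ is a covariance matrix, i.e. Hermitian positive semidefinite. Write singular value decompositions $C=\mathbb U\mathbb S\mathbb V^H$ and $\tilde C=\tilde{\mathbb U}\tilde{\mathbb S}\tilde{\mathbb V}^H$, with singular values in decreasing order, and let $\zeta_1,\dots,\zeta_N$ and $\psi_1,\dots,\psi_N$ be the (orthonormal) columns of $\mathbb U$ and $\tilde{\mathbb U}$, respectively. Set $\tilde{\mathcal S}_K=\operatorname{span}\{\psi_1,\dots,\psi_K\}$. The discrete contrast source is the random vector $\hat\phi=\sum_{n=1}^N a_n\sqrt{\lambda_n}\,\zeta_n\in\mathbb C^N$, where $a_1,\dots,a_N$ are random variables with zero mean and variance $1$. Its truncation is $\hat\phi_K=\sum_{n=1}^K a_n\sqrt{\lambda_n}\,\zeta_n$, and $\tilde\phi_K$ is the orthogonal projection of $\hat\phi$ (not of $\hat\phi_K$) onto $\tilde{\mathcal S}_K$. $\|\cdot\|_2$ denotes the Euclidean norm for vectors and the spectral norm for matrices. A ratio $\lambda_i/\lambda_{i+1}$ with $\lambda_{i+1}=0$ is interpreted as $+\infty$. *)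

(* Defs.v *)
From HB Require Import structures.
From mathcomp Require Export all_boot all_order all_algebra.
From mathcomp Require Export spectral.
From mathcomp Require Export complex.
From mathcomp Require Export all_classical all_reals all_analysis.

Set Implicit Arguments.
Unset Strict Implicit.
Unset Printing Implicit Defensive.

Export Order.TTheory GRing.Theory Num.Theory.
Export numFieldNormedType.Exports.

Local Open Scope classical_set_scope.
Local Open Scope ring_scope.
Local Open Scope complex_scope.
Local Open Scope sesquilinear_scope.

(* Singular values are families [s : nat -> R] indexed from 1: only            *)
(* [s 1, ..., s N] are used. Matrix columns and the random coefficients are    *)
(* indexed by ['I_N], so that [i : 'I_N] stands for the index [i.+1].          *)

Section Matrices.
Context {R : realType}.

Definition enorm n (x : 'cV[R[i]]_n) : R :=
  Num.sqrt (\sum_(j < n) Normc.normc (x j 0) ^+ 2).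

Definition spectral_norm m n (A : 'M[R[i]]_(m, n)) : R :=
  sup [set enorm (A *m x) | x in [set x : 'cV[R[i]]_n | enorm x <= 1]].

(* [0 <= z] on [R[i]] means that [z] is real and nonnegative. *)
Definition hermitian_psd n (A : 'M[R[i]]_n) : Prop :=
  A \is hermsymmx /\ forall x : 'cV[R[i]]_n, 0 <= (x ^t* *m A *m x) 0 0.

Definition is_svd n (A U : 'M[R[i]]_n) (s : nat -> R) (V : 'M[R[i]]_n) : Prop :=
  [/\ U \is unitarymx, V \is unitarymx,
      forall i : 'I_n, 0 <= s i.+1,
      forall i j : 'I_n, (i <= j)%N -> s j.+1 <= s i.+1 &
      A = U *m diag_mx (\row_(j < n) (s j.+1)%:C) *m V ^t*].

(* MathComp subspaces are row spaces, hence the transpositions. *)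
Definition lead_span n (U : 'M[R[i]]_n) (K : nat) : 'M[R[i]]_n :=
  (\sum_(j < n | (j < K)%N) <<(col j U)^T>>)%MS.

Definition orth_proj n (S : 'M[R[i]]_n) (x : 'cV[R[i]]_n) : 'cV[R[i]]_n :=
  (x^T *m proj_ortho S)^T.

Definition eratio (x y : R) : \bar R := if y == 0 then +oo%E else (x / y)%:E.

Definition tail_sum (N : nat) (s : nat -> R) (k : nat) : R :=
  \sum_(k.+1 <= n < N.+1) s n.

End Matrices.

Section Randomness.
Context {R : realType} {d : measure_display} {Omega : measurableType d}.
Variable P : probability Omega R.

Definition cmean (X : Omega -> R[i]) : R[i] :=
  fine ('E_P[fun w => complex.Re (X w)])%E
  +i* fine ('E_P[fun w => complex.Im (X w)])%E.

Definition cvariance (X : Omega -> R[i]) : \bar R :=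
  ('E_P[fun w => (Normc.normc (X w - cmean X) ^+ 2)%R])%E.

(* Integrability of [X] follows from the finiteness of its variance. *)
Definition zero_mean_unit_variance (X : Omega -> R[i]) : Prop :=
  [/\ measurable_fun setT (fun w => complex.Re (X w)),
      measurable_fun setT (fun w => complex.Im (X w)),
      cmean X = 0 & cvariance X = 1%E].

End Randomness.

Section Contrast.
Context {R : realType} {Omega : Type} {N : nat}.
Variables (a : 'I_N -> Omega -> R[i]) (lam : nat -> R) (U Ut : 'M[R[i]]_N).

Definition contrast (w : Omega) : 'cV[R[i]]_N :=
  \sum_(n < N) (a n w * (Num.sqrt (lam n.+1))%:C) *: col n U.

Definition contrast_trunc (K : nat) (w : Omega) : 'cV[R[i]]_N :=
  \sum_(n < N | (n < K)%N) (a n w * (Num.sqrt (lam n.+1))%:C) *: col n U.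

Definition contrast_proj (K : nat) (w : Omega) : 'cV[R[i]]_N :=
  orth_proj (lead_span Ut K) (contrast w).

End Contrast.

(* Main.v *)
(** With [P_k] the projection onto the first [k] singular directions of [C], [Q_k]
    the projection onto the complement of the first [k] perturbed directions, and
    [r] the tail of the contrast source, the error is
    [Q_K (phi_K) - (1 - Q_K) r]; the second term contributes [sqrt eps_K].
    Wedin's argument on both singular subspaces, with Weyl's inequality for the
    perturbed singular values, gives
    [|Q_k P_k| <= 2 |Cd| / (lam_k - lam_(k+1))] for every [k]: either the right-hand
    side is at least [1], or the perturbed gap is at least half the original one.
    This is used once with [k = T] on the span of the first [T] vectors, where
    [|Q_K P_T| <= |Q_T P_T|], and once with [k = n] on each single direction
    [T < n <= K]; there the geometric decay bounds the gap below by
    [lam_n (L - 1) / L]. *)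

Require Import Defs.
From mathcomp Require Import measurable_realfun ring lra.

Set Implicit Arguments.
Unset Strict Implicit.
Unset Printing Implicit Defensive.

Local Open Scope ring_scope.
Local Open Scope complex_scope.
Local Open Scope sesquilinear_scope.

(** * Euclidean norm and spectral norm of complex vectors and matrices *)

Section EuclideanNorm.
Context {R : realType}.
Implicit Types n : nat.

Lemma normcE_norm (z : R[i]) : (Normc.normc z)%:C = `|z|.
Proof. by case: z. Qed.

Lemma normc_real (x : R) : Normc.normc x%:C = `|x|.
Proof. by rewrite /= expr0n /= addr0 sqrtr_sqr. Qed.

Lemma normc_ge0 (z : R[i]) : 0 <= Normc.normc z.
Proof. by case: z => ? ?; exact: sqrtr_ge0. Qed.

Lemma enorm_ge0 n (x : 'cV[R[i]]_n) : 0 <= enorm x.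
Proof. exact: sqrtr_ge0. Qed.

Lemma sqr_enorm n (x : 'cV[R[i]]_n) :
  enorm x ^+ 2 = \sum_(j < n) Normc.normc (x j 0) ^+ 2.
Proof. by rewrite sqr_sqrtr// sumr_ge0// => j _; rewrite sqr_ge0. Qed.

Lemma sqr_enormC n (x : 'cV[R[i]]_n) : ((enorm x ^+ 2)%:C = (x ^t* *m x) 0 0).
Proof.
rewrite sqr_enorm rmorph_sum mxE; apply: eq_bigr => j _ /=.
by rewrite rmorphXn /= normcE_norm !mxE normCK mulrC.
Qed.

(** A bridge to the Hermitian form [dotmx] on row vectors, from which the triangle inequality and
    definiteness are inherited. *)
Lemma enorm_dotmx n (x : 'cV[R[i]]_n) : (enorm x)%:C = sqrtC (dotmx x^T x^T).
Proof.
rewrite -[LHS]sqrCK ?lecR ?enorm_ge0// -rmorphXn /= sqr_enorm; congr sqrtC.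
rewrite rmorph_sum dotmxE mxE; apply: eq_bigr => j _ /=.
by rewrite rmorphXn /= normcE_norm !mxE normCK.
Qed.

Lemma ler_enormD n (x y : 'cV[R[i]]_n) : enorm (x + y) <= enorm x + enorm y.
Proof.
rewrite -lecR rmorphD /= !enorm_dotmx linearD /=.
by case: (triangle_lerif (@dotmx _ n) x^T y^T).
Qed.

Lemma enormZ n (c : R[i]) (x : 'cV[R[i]]_n) :
  enorm (c *: x) = Normc.normc c * enorm x.
Proof.
apply/eqP; rewrite -(@eqrXn2 _ 2) ?mulr_ge0 ?enorm_ge0 ?normc_ge0//.
rewrite exprMn !sqr_enorm mulr_sumr; apply/eqP/eq_bigr => j _.
by rewrite mxE Normc.normcM exprMn.
Qed.

Lemma enormN n (x : 'cV[R[i]]_n) : enorm (- x) = enorm x.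
Proof. by rewrite -scaleN1r enormZ normcN Normc.normc1 mul1r. Qed.

Lemma ler_enormB n (x y : 'cV[R[i]]_n) : enorm (x - y) <= enorm x + enorm y.
Proof. by rewrite (le_trans (ler_enormD _ _))// enormN. Qed.

Lemma enorm0 n : enorm (0 : 'cV[R[i]]_n) = 0.
Proof. by rewrite -(scale0r 0) enormZ Normc.normc0 mul0r. Qed.

Lemma enorm_eq0 n (x : 'cV[R[i]]_n) : enorm x = 0 -> x = 0.
Proof.
move=> x0; have /eqP := enorm_dotmx x; rewrite x0 eq_sym.
by rewrite sqrtC_eq0 dnorm_eq0  => /eqP xT0; rewrite -[x]trmxK xT0 trmx0.
Qed.

Lemma ler_enorm_sum n (I : finType) (p : pred I) (x : I -> 'cV[R[i]]_n) :
  enorm (\sum_(i | p i) x i) <= \sum_(i | p i) enorm (x i).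
Proof.
elim/big_ind2: _ => [|u v x' y' h1 h2|//]; first by rewrite enorm0.
by rewrite (le_trans (ler_enormD _ _))// lerD.
Qed.

Lemma enorm_le_scale n (c : R) (x y : 'cV[R[i]]_n) : 0 <= c ->
  (forall j, Normc.normc (x j 0) <= c * Normc.normc (y j 0)) ->
  enorm x <= c * enorm y.
Proof.
move=> c0 xy; rewrite -(@ler_pXn2r _ 2) ?nnegrE ?mulr_ge0 ?enorm_ge0//.
rewrite exprMn !sqr_enorm mulr_sumr ler_sum// => j _.
by rewrite -exprMn lerXn2r ?nnegrE ?mulr_ge0 ?normc_ge0.
Qed.

Lemma normc_le_enorm n (x : 'cV[R[i]]_n) j : Normc.normc (x j 0) <= enorm x.
Proof.
rewrite -(@ler_pXn2r _ 2) ?nnegrE ?normc_ge0 ?enorm_ge0// sqr_enorm.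
by rewrite (bigD1 j)//= lerDl sumr_ge0// => i _; rewrite sqr_ge0.
Qed.

Lemma unitarymxPV n (W : 'M[R[i]]_n) : W \is unitarymx -> W ^t* *m W = 1%:M.
Proof. by rewrite -trmxC_unitary => /unitarymxP; rewrite trmxCK. Qed.

Lemma enorm_unitary n (W : 'M[R[i]]_n) (x : 'cV[R[i]]_n) : W \is unitarymx ->
  enorm (W *m x) = enorm x.
Proof.
move=> Wu; apply/eqP; rewrite -(@eqrXn2 _ 2) ?enorm_ge0//; apply/eqP/complexI.
rewrite !sqr_enormC trmx_mul map_mxM mulmxA -(mulmxA _ _ W).
by rewrite (unitarymxPV Wu) mulmx1.
Qed.

(** A real [sup] is meaningful only for a bounded set. The entries of a vector in the unit ball have
    modulus at most 1, so the sum of the column norms is a bound. *)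
Lemma spectral_norm_ub m n (A : 'M[R[i]]_(m, n)) :
  has_ubound [set enorm (A *m x) | x in [set x : 'cV[R[i]]_n | enorm x <= 1]]%classic.
Proof.
exists (\sum_(j < n) enorm (col j A)) => _ /= [x x1 <-].
have -> : A *m x = \sum_(j < n) x j 0 *: col j A.
  apply/matrixP => i k; rewrite ord1 mxE summxE; apply: eq_bigr => j _.
  by rewrite !mxE mulrC.
apply: le_trans (ler_enorm_sum _ _) _; apply: ler_sum => j _.
rewrite enormZ ler_piMl ?enorm_ge0//.
exact: le_trans (normc_le_enorm _ _) x1.
Qed.

Lemma le_spectral_norm m n (A : 'M[R[i]]_(m, n)) x :
  enorm (A *m x) <= spectral_norm A * enorm x.
Proof.
have [x0|x0] := eqVneq (enorm x) 0.
  by rewrite x0 mulr0 (enorm_eq0 x0) mulmx0 enorm0.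
have xp : 0 < enorm x by rewrite lt_neqAle eq_sym x0 enorm_ge0.
rewrite -ler_pdivrMr//; apply: ub_le_sup; first exact: spectral_norm_ub.
exists ((enorm x)^-1%:C *: x).
  by rewrite /= enormZ normc_real gtr0_norm ?invr_gt0// mulVf.
by rewrite -scalemxAr enormZ normc_real gtr0_norm ?invr_gt0// mulrC.
Qed.

Lemma spectral_norm_ge0 m n (A : 'M[R[i]]_(m, n)) : 0 <= spectral_norm A.
Proof.
apply: ub_le_sup; first exact: spectral_norm_ub.
by exists 0; rewrite /= ?mulmx0 enorm0.
Qed.

Lemma spectral_norm_le m n (A : 'M[R[i]]_(m, n)) c : 0 <= c ->
  (forall x, enorm (A *m x) <= c * enorm x) -> spectral_norm A <= c.
Proof.
move=> c0 Ac; apply: ge_sup; first by exists (enorm (A *m 0)), 0; rewrite //= enorm0.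
by move=> _ /= [x x1 <-]; rewrite (le_trans (Ac x))// ler_piMr.
Qed.

End EuclideanNorm.

(** * Perturbation of singular values and singular subspaces *)

Section SingularSubspaces.
Context {R : realType} {n : nat}.
Implicit Types (A B E U V W : 'M[R[i]]_n) (s : nat -> R) (x y : 'cV[R[i]]_n).

Definition sv_mx s : 'M[R[i]]_n := diag_mx (\row_(j < n) (s j.+1)%:C).

(** Projections in coordinates: for unitary [U], [U *m lo_mx k *m U ^t*] projects onto the first [k]
    columns of [U], and [hi_mx] gives the complement. All operators on a singular basis thus stay
    diagonal. *)
Definition lo_mx k : 'M[R[i]]_n := diag_mx (\row_(j < n) (j < k)%N%:R).
Definition hi_mx k : 'M[R[i]]_n := diag_mx (\row_(j < n) (k <= j)%N%:R).

Lemma adj_unitary W : W \is unitarymx -> W ^t* \is unitarymx.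
Proof. by move=> Wu; rewrite (trmxC_unitary W). Qed.

Lemma diag_mulE (r : 'rV[R[i]]_n) x j : (diag_mx r *m x) j 0 = r 0 j * x j 0.
Proof. by rewrite mul_diag_mx mxE. Qed.

Lemma lo_mxE k x j : (lo_mx k *m x) j 0 = (if (j < k)%N then x j 0 else 0).
Proof. by rewrite diag_mulE mxE; case: ifP; rewrite ?mul1r ?mul0r. Qed.

Lemma hi_mxE k x j : (hi_mx k *m x) j 0 = (if (k <= j)%N then x j 0 else 0).
Proof. by rewrite diag_mulE mxE; case: ifP; rewrite ?mul1r ?mul0r. Qed.

Lemma sv_mxE s x j : (sv_mx s *m x) j 0 = (s j.+1)%:C * x j 0.
Proof. by rewrite diag_mulE mxE. Qed.

Lemma lo_hi_mx k x : lo_mx k *m x + hi_mx k *m x = x.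
Proof.
apply/colP => j; rewrite mxE lo_mxE hi_mxE ltnNge.
by case: (k <= j)%N; rewrite ?add0r ?addr0.
Qed.

Lemma diag_mxCC (r q : 'rV[R[i]]_n) : diag_mx r *m diag_mx q = diag_mx q *m diag_mx r.
Proof.
by rewrite !mulmx_diag; congr diag_mx; apply/rowP => j; rewrite !mxE mulrC.
Qed.

Lemma enorm_lo_le k x : enorm (lo_mx k *m x) <= enorm x.
Proof.
rewrite -[leRHS]mul1r; apply: enorm_le_scale => // j; rewrite mul1r lo_mxE.
by case: ifP => // _; rewrite Normc.normc0 normc_ge0.
Qed.

Lemma enorm_hi_le k x : enorm (hi_mx k *m x) <= enorm x.
Proof.
rewrite -[leRHS]mul1r; apply: enorm_le_scale => // j; rewrite mul1r hi_mxE.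
by case: ifP => // _; rewrite Normc.normc0 normc_ge0.
Qed.

Lemma enorm_hi_anti k m x : (m <= k)%N ->
  enorm (hi_mx k *m x) <= enorm (hi_mx m *m x).
Proof.
move=> mk; rewrite -[leRHS]mul1r; apply: enorm_le_scale => // j.
rewrite mul1r !hi_mxE; case: (leqP k j) => [kj|_].
  by rewrite (leq_trans mk kj).
by rewrite Normc.normc0 normc_ge0.
Qed.

Lemma svd_adjoint A U s V : is_svd A U s V -> is_svd (A ^t*) V s U.
Proof.
case=> Uu Vu s0 sd ->; split=> //.
rewrite !trmx_mul !map_mxM /= trmxCK mulmxA; congr (_ *m _ *m _).
rewrite tr_diag_mx map_diag_mx; congr diag_mx; apply/rowP => j; rewrite !mxE.
exact: conjc_real.
Qed.

Lemma svd_mulV A U s V : is_svd A U s V -> A *m V = U *m sv_mx s.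
Proof. by case=> _ Vu _ _ ->; rewrite -mulmxA (unitarymxPV Vu) mulmx1. Qed.

Lemma svd_Umul A U s V : is_svd A U s V -> U ^t* *m A = sv_mx s *m V ^t*.
Proof. by case=> Uu _ _ _ ->; rewrite !mulmxA (unitarymxPV Uu) mul1mx. Qed.

Lemma svd_ge0 A U s V k : is_svd A U s V -> (k < n)%N -> 0 <= s k.+1.
Proof. by case=> _ _ s0 _ _ kn; exact: (s0 (Ordinal kn)). Qed.

Lemma svd_le A U s V k m : is_svd A U s V -> (k <= m < n)%N -> s m.+1 <= s k.+1.
Proof.
case=> _ _ _ sd _ /andP[km mn].
exact: (sd (Ordinal (leq_ltn_trans km mn)) (Ordinal mn)).
Qed.

Lemma svd_lead_le A U s V k j : is_svd A U s V -> (j < k <= n)%N ->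
  s k <= s j.+1.
Proof.
by move=> svdA; case: k => [//|k] /andP[jk kn]; rewrite (svd_le svdA)// -ltnS jk.
Qed.

Lemma enorm_sv_hi A U s V k x : is_svd A U s V -> (k < n)%N ->
  enorm (hi_mx k *m (sv_mx s *m x)) <= s k.+1 * enorm (hi_mx k *m x).
Proof.
move=> svdA kn; apply: enorm_le_scale => [|j]; first exact: svd_ge0 svdA kn.
rewrite !hi_mxE; case: ifP => [kj|_]; last by rewrite Normc.normc0 mulr0.
rewrite sv_mxE Normc.normcM normc_real ger0_norm ?(svd_ge0 svdA)//.
by rewrite ler_wpM2r ?normc_ge0// (svd_le svdA)// kj /=.
Qed.

(* The [n] by [n] matrix below has a vanishing row [k], which supplies the
   vector of the min-max argument: it lies in the span of the first [k.+1]
   right singular vectors of [B] and is orthogonal to the first [k] of [A]. *)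
Lemma singular_value_perturb A B U V Ut Vt s st k c :
  is_svd A U s V -> is_svd B Ut st Vt -> (k < n)%N ->
  (forall x, enorm ((B - A) *m x) <= c * enorm x) ->
  st k.+1 <= s k.+1 + c.
Proof.
move=> svdA svdB kn Ec.
have [[Uu Vu _ _ defA] [Utu Vtu _ _ defB]] := (svdA, svdB).
pose G := lo_mx k *m (V ^t* *m Vt) + hi_mx k.+1.
have Grow x j : (G *m x) j 0 = (if (j < k)%N then (V ^t* *m Vt *m x) j 0 else 0)
                               + (if (k < j)%N then x j 0 else 0).
  by rewrite mulmxDl mxE -(mulmxA (lo_mx k)) lo_mxE hi_mxE.
have : \det G^T == 0.
  rewrite det_tr; apply/det0P; exists (delta_mx 0 (Ordinal kn)).
    by apply/eqP => /rowP/(_ (Ordinal kn)); rewrite !mxE !eqxx => /eqP; rewrite oner_eq0.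
  apply/rowP => j; rewrite -rowE mxE mxE [in RHS]mxE mul_diag_mx !mxE /= ltnn.
  by rewrite mul0r mul0rn addr0.
case/det0P => v v0 vG0.
have Gv0 : G *m v^T = 0 by rewrite -[G]trmxK -trmx_mul vG0 trmx0.
set x := v^T in Gv0.
have x0 : 0 < enorm x.
  rewrite lt_neqAle enorm_ge0 andbT eq_sym; apply: contra v0 => /eqP/enorm_eq0 /eqP.
  by rewrite trmx_eq0.
have xhi (j : 'I_n) : (k < j)%N -> x j 0 = 0.
  move=> kj; have := Grow x j; rewrite Gv0 mxE kj ltnNge (ltnW kj) /= add0r.
  by move=> <-.
have Vlo : hi_mx k *m (V ^t* *m Vt *m x) = V ^t* *m Vt *m x.
  apply/colP => j; rewrite hi_mxE; case: leqP => // jk.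
  by have := Grow x j; rewrite Gv0 mxE jk ltnNge (ltnW jk) /= addr0.
(* Only the first [k.+1] coordinates of [x] survive, and there each singular value of [B] is at
   least [st k.+1]. The case of value 0 is split off because the comparison divides by it. *)
have lower : st k.+1 * enorm x <= enorm (B *m (Vt *m x)).
  rewrite (mulmxA B) (svd_mulV svdB) -(mulmxA Ut) (enorm_unitary _ Utu).
  have [->|stk0] := eqVneq (st k.+1) 0; first by rewrite mul0r enorm_ge0.
  have stk : 0 < st k.+1 by rewrite lt_neqAle eq_sym stk0 (svd_ge0 svdB).
  rewrite -ler_pdivlMl//; apply: enorm_le_scale => [|j]; first by rewrite invr_ge0 ltW.
  rewrite sv_mxE Normc.normcM normc_real ger0_norm ?(svd_ge0 svdB)//.
  rewrite ler_pdivlMl//; have [/xhi->|jk] := ltnP k j.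
    by rewrite Normc.normc0 !mulr0.
  by rewrite ler_wpM2r ?normc_ge0// (svd_le svdB)// jk kn.
(* In the right singular basis of [A] the vector has no coordinate among the first [k], so [A]
   stretches it by at most [s k.+1]. *)
have upper : enorm (A *m (Vt *m x)) <= s k.+1 * enorm x.
  rewrite -(enorm_unitary (A *m (Vt *m x)) (adj_unitary Uu)) mulmxA (svd_Umul svdA).
  rewrite -(mulmxA (sv_mx s) (V ^t*)) (mulmxA (V ^t*)) -Vlo.
  rewrite (mulmxA (sv_mx s)) [sv_mx s *m hi_mx k]diag_mxCC -mulmxA.
  rewrite (le_trans (enorm_sv_hi _ svdA kn))// Vlo -mulmxA.
  by rewrite (enorm_unitary _ (adj_unitary Vu)) (enorm_unitary _ Vtu).
rewrite -(ler_pM2r x0) (le_trans lower)//.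
have -> : B *m (Vt *m x) = A *m (Vt *m x) + (B - A) *m (Vt *m x).
  by rewrite -mulmxDl addrC subrK.
rewrite (le_trans (ler_enormD _ _))// mulrDl lerD//.
by rewrite (le_trans (Ec _))// (enorm_unitary _ Vtu).
Qed.

(** Bounds the left subspaces by the right ones. On the first [k] directions [U] is [A *m V] up to
    division by singular values at least [s k]. Writing [A] as [B - (B - A)], the part with [B]
    passes to the right singular vectors with factor at most [st k.+1], and the rest costs [c]. *)
Lemma wedin_step A B U V Ut Vt s st k c b :
  is_svd A U s V -> is_svd B Ut st Vt -> (0 < k < n)%N -> 0 < s k ->
  0 <= b -> 0 <= c ->
  (forall x, enorm ((B - A) *m x) <= c * enorm x) ->
  (forall x, enorm (hi_mx k *m (Vt ^t* *m (V *m (lo_mx k *m x)))) <= b * enorm x) ->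
  forall x, enorm (hi_mx k *m (Ut ^t* *m (U *m (lo_mx k *m x))))
            <= (st k.+1 * b + c) / s k * enorm x.
Proof.
move=> svdA svdB /andP[k0 kn] sk b0 c0 Ec Gb x.
have [[Uu Vu _ _ defA] [Utu Vtu _ _ defB]] := (svdA, svdB).
(* The inverse of [sv_mx s] on the first [k] coordinates, where the singular values are positive. *)
pose w : 'cV[R[i]]_n := \col_j (if (j < k)%N then ((s j.+1)^-1)%:C * x j 0 else 0).
have sge (j : 'I_n) : (j < k)%N -> s k <= s j.+1.
  by move=> jk; rewrite (svd_lead_le svdA)// jk ltnW.
have wlo : lo_mx k *m w = w.
  by apply/colP => j; rewrite lo_mxE !mxE; case: (_ < _)%N.
have -> : lo_mx k *m x = sv_mx s *m w.
  apply/colP => j; rewrite lo_mxE sv_mxE mxE; case: ifP => [jk|]; last by rewrite mulr0.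
  by rewrite mulrA -rmorphM /= divff ?mul1r// gt_eqF// (lt_le_trans sk)// sge.
have wx : enorm w <= (s k)^-1 * enorm x.
  apply: enorm_le_scale => [|j]; first by rewrite invr_ge0 ltW.
  rewrite mxE; case: ifP => [jk|]; last first.
    by rewrite Normc.normc0 mulr_ge0 ?normc_ge0// invr_ge0 ltW.
  have sj : 0 < s j.+1 by rewrite (lt_le_trans sk)// sge.
  rewrite Normc.normcM normc_real ger0_norm ?invr_ge0 ?(ltW sj)//.
  by rewrite ler_wpM2r ?normc_ge0// lef_pV2 ?posrE// sge.
rewrite [U *m _]mulmxA -(svd_mulV svdA) -[A *m V *m w]mulmxA.
have -> : A *m (V *m w) = B *m (V *m w) - (B - A) *m (V *m w).
  by rewrite mulmxBl opprB addrC subrK.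
rewrite mulmxBr mulmxBr (le_trans (ler_enormB _ _))//.
apply: (@le_trans _ _ ((st k.+1 * b + c) * enorm w)); last first.
  rewrite -mulrA ler_wpM2l// addr_ge0// mulr_ge0//.
  exact: svd_ge0 svdB kn.
rewrite mulrDl; apply: lerD.
  rewrite [Ut ^t* *m _]mulmxA (svd_Umul svdB) -[_ *m (V *m w)]mulmxA.
  rewrite (le_trans (enorm_sv_hi _ svdB kn))// -mulrA ler_wpM2l//.
    exact: svd_ge0 svdB kn.
  by rewrite -{1}wlo Gb.
rewrite (le_trans (enorm_hi_le _ _))// (enorm_unitary _ (adj_unitary Utu)).
by rewrite (le_trans (Ec _))// (enorm_unitary _ Vu).
Qed.

Lemma wedin A B U V Ut Vt s st k c :
  is_svd A U s V -> is_svd B Ut st Vt -> (0 < k < n)%N -> s k.+1 < s k ->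
  0 <= c ->
  (forall x, enorm ((B - A) *m x) <= c * enorm x) ->
  (forall x, enorm ((B - A) ^t* *m x) <= c * enorm x) ->
  forall x, enorm (hi_mx k *m (Ut ^t* *m (U *m (lo_mx k *m x))))
            <= 2 * c / (s k - s k.+1) * enorm x.
Proof.
move=> svdA svdB /[dup] kkn /andP[k0 kn] gap c0 Ec Ecs x.
have [[Uu Vu _ _ _] [Utu Vtu _ _ _]] := (svdA, svdB).
have sk : 0 < s k by rewrite (le_lt_trans _ gap)// (svd_ge0 svdA).
have weyl := singular_value_perturb svdA svdB kn Ec.
have st0 := svd_ge0 svdB kn.
(* For a large perturbation the claimed factor is at least 1, and a composite of contractions
   satisfies the bound trivially. *)
have [cbig|csmall] := leP (s k - s k.+1) (2 * c).
  rewrite (@le_trans _ _ (1 * enorm x))//; last first.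
    by rewrite ler_wpM2r ?enorm_ge0// ler_pdivlMr ?subr_gt0// mul1r.
  rewrite mul1r (le_trans (enorm_hi_le _ _))//.
  rewrite (enorm_unitary _ (adj_unitary Utu)) (enorm_unitary _ Uu).
  exact: enorm_lo_le.
have [GU GUE] : exists G, forall y,
    hi_mx k *m (Ut ^t* *m (U *m (lo_mx k *m y))) = G *m y.
  by exists (hi_mx k *m Ut ^t* *m U *m lo_mx k) => y; rewrite !mulmxA.
have [GV GVE] : exists G, forall y,
    hi_mx k *m (Vt ^t* *m (V *m (lo_mx k *m y))) = G *m y.
  by exists (hi_mx k *m Vt ^t* *m V *m lo_mx k) => y; rewrite !mulmxA.
(* [wedin_step] bounds the left norm by the right one and, applied to the adjoints, the right by the
   left. The maximum of the two closes the loop into a self-referential inequality for [b]. *)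
pose b := Num.max (spectral_norm GU) (spectral_norm GV).
have max_ub (p q : R) : p <= Num.max p q /\ q <= Num.max p q.
  by rewrite !le_max !lexx orbT.
have [bU bV] : spectral_norm GU <= b /\ spectral_norm GV <= b := max_ub _ _.
have b0 : 0 <= b := le_trans (spectral_norm_ge0 GU) bU.
have step : b <= (st k.+1 * b + c) / s k.
  have b'0 : 0 <= (st k.+1 * b + c) / s k.
    by rewrite divr_ge0 ?(ltW sk)// addr_ge0// mulr_ge0.
  rewrite /b ge_max; apply/andP; split; apply: spectral_norm_le => // y.
    rewrite -GUE; apply: wedin_step (svdA) (svdB) _ _ _ _ Ec _ y => // y.
    rewrite GVE.
    exact: le_trans (le_spectral_norm GV y) (ler_wpM2r (enorm_ge0 y) bV).
  have Ecs' z : enorm ((B ^t* - A ^t*) *m z) <= c * enorm z.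
    by rewrite -map_mxB -linearB /= Ecs.
  rewrite -GVE.
  apply: wedin_step (svd_adjoint svdA) (svd_adjoint svdB) _ _ _ _ Ecs' _ y => // y.
  rewrite GUE.
  exact: le_trans (le_spectral_norm GU y) (ler_wpM2r (enorm_ge0 y) bU).
rewrite GUE (le_trans (le_spectral_norm _ _))// ler_wpM2r ?enorm_ge0//.
apply: (le_trans bU).
rewrite ler_pdivlMr ?subr_gt0//; move: step; rewrite ler_pdivlMr// => step.
(* Inserting Weyl's bound for [st k.+1] into [step] gives [(s k - s k.+1 - c) * b <= c]; as [c] is
   below half the gap, the factor of [b] is at least half the gap. *)
have weyl_b : 0 <= (s k.+1 + c - st k.+1) * b by rewrite mulr_ge0// subr_ge0.
have small_b : 0 <= (s k - s k.+1 - 2 * c) * b by rewrite mulr_ge0// subr_ge0 ltW.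
lra.
Qed.

End SingularSubspaces.

(** * Projection onto the perturbed subspace and the pointwise error *)

Section Projection.
Context {R : realType} {n : nat}.
Implicit Types (U Ut : 'M[R[i]]_n) (x y z : 'cV[R[i]]_n).

(** The low part of [y] gives a combination of the spanning columns, which the projection fixes; the
    high part is orthogonal to them and is killed. *)
Lemma orth_proj_lead_span Ut k y : Ut \is unitarymx ->
  orth_proj (lead_span Ut k) (Ut *m y) = Ut *m (lo_mx k *m y).
Proof.
move=> Utu; rewrite -{1}(lo_hi_mx k y) mulmxDr /orth_proj linearD /= mulmxDl.
rewrite proj_ortho_id; last first.
  have -> : (Ut *m (lo_mx k *m y))^T = \sum_(j < n | (j < k)%N) y j 0 *: (col j Ut)^T.
    apply/rowP => i; rewrite !mxE summxE [RHS]big_mkcond /=; apply: eq_bigr => j _.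
    by rewrite lo_mxE; case: ifP => _; rewrite ?mulr0// !mxE mulrC.
  apply: summx_sub => j jk; apply: scalemx_sub.
  by apply: (sumsmx_sup j) => //; rewrite genmxE.
rewrite proj_ortho_0 ?addr0 ?trmxK// orthomx_sym.
apply/sumsmx_subP => j jk; rewrite genmxE; apply/orthomx1P/matrixP => p q.
have : (Ut ^t* *m (Ut *m (hi_mx k *m y))) j 0 = 0.
  by rewrite (mulmxA (Ut ^t*)) (unitarymxPV Utu) mul1mx hi_mxE leqNgt jk.
(* The row-space orthogonality product conjugates its second argument, so it is the conjugate of the
   vanishing coordinate just computed. *)
move: (Ut *m _) => v /(congr1 Num.conj); rewrite conjC0 => v0; rewrite !ord1 [RHS]mxE -v0.
rewrite !mxE rmorph_sum; apply: eq_bigr => i _ /=.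
by rewrite rmorphM !mxE /= conjCK.
Qed.

Lemma enorm_delta (c : R[i]) (j : 'I_n) :
  enorm (c *: (delta_mx j 0 : 'cV[R[i]]_n)) = Normc.normc c.
Proof.
rewrite enormZ /enorm (bigD1 j)//= big1 => [|i ij]; last first.
  by rewrite mxE (negbTE ij) Normc.normc0 expr0n.
by rewrite mxE !eqxx Normc.normc1 addr0 expr1n sqrtr1 mulr1.
Qed.

(** The factor [lo_mx j.+1] acts as the identity on the [j]-th basis vector; it is kept so that the
    subspace bound of level [j.+1] applies to each term. *)
Lemma lo_mx_split m k x : (m <= k)%N ->
  lo_mx k *m x = lo_mx m *m x
    + \sum_(j < n | (m <= j < k)%N) lo_mx j.+1 *m (x j 0 *: delta_mx j 0).
Proof.
move=> mk; apply/colP => i; rewrite [RHS]mxE summxE !lo_mxE.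
have E (j : 'I_n) : 
    (lo_mx j.+1 *m (x j 0 *: delta_mx j 0) : 'cV_n) i 0 = x j 0 *+ (i == j).
  rewrite lo_mxE !mxE eqxx andbT; have [->|ij] := eqVneq i j.
    by rewrite ltnSn mulr1.
  by rewrite mulr0 if_same.
under eq_bigr do rewrite E.
have [im|mi] := ltnP i m.
  rewrite (leq_trans im mk) big1 ?addr0// => j /andP[mj _].
  by case: eqVneq => // ij; move: im; rewrite ij ltnNge mj.
have [ik|ki] := ltnP i k.
  rewrite (bigD1 i) ?mi//= eqxx big1 ?addr0 ?add0r// => j /andP[_ ji].
  by rewrite eq_sym (negbTE ji).
rewrite big1 ?addr0// => j /andP[_ jk].
by case: eqVneq => // ij; move: jk; rewrite -ij ltnNge ki.
Qed.

(** The first [m] directions are estimated as one block with [g m], each later one alone with its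
    own [g j.+1]. A bound at level [l <= k] suffices, since [hi_mx k] cuts off more than
    [hi_mx l]. *)
Lemma trunc_sub_proj_le U Ut (g : nat -> R) m k z :
  U \is unitarymx -> Ut \is unitarymx -> (m <= k)%N -> 0 <= g m ->
  (forall l, (m <= l <= k)%N -> forall x,
    enorm (hi_mx l *m (Ut ^t* *m (U *m (lo_mx l *m x)))) <= g l * enorm x) ->
  enorm (U *m (lo_mx k *m z) - Ut *m (lo_mx k *m (Ut ^t* *m (U *m z))))
  <= enorm (hi_mx k *m z) + g m * enorm z
     + \sum_(j < n | (m <= j < k)%N) g j.+1 * Normc.normc (z j 0).
Proof.
move=> Uu Utu mk gm0 Hg.
(* Splitting [z] into head and tail: the head leaves its component outside the perturbed subspace,
   the tail leaves its component inside. *)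
have -> : U *m (lo_mx k *m z) - Ut *m (lo_mx k *m (Ut ^t* *m (U *m z)))
   = Ut *m (hi_mx k *m (Ut ^t* *m (U *m (lo_mx k *m z))))
     - Ut *m (lo_mx k *m (Ut ^t* *m (U *m (hi_mx k *m z)))).
  rewrite -{2}(lo_hi_mx k z) !mulmxDr opprD addrA; congr (_ - _).
  apply/eqP; rewrite subr_eq -mulmxDr addrC lo_hi_mx (mulmxA Ut).
  by move/unitarymxP: Utu => ->; rewrite mul1mx.
rewrite (le_trans (ler_enormB _ _))// addrC -addrA lerD//.
  rewrite (enorm_unitary _ Utu) (le_trans (enorm_lo_le _ _))//.
  by rewrite (enorm_unitary _ (adj_unitary Utu)) (enorm_unitary _ Uu).
have Hk l x : (m <= l <= k)%N ->
    enorm (hi_mx k *m (Ut ^t* *m (U *m (lo_mx l *m x)))) <= g l * enorm x.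
  by move=> /[dup] lmk /andP[_ lk]; rewrite (le_trans (enorm_hi_anti _ lk)) ?Hg.
rewrite (enorm_unitary _ Utu) (lo_mx_split z mk) !mulmxDr.
rewrite (le_trans (ler_enormD _ _))// lerD//; first by rewrite Hk ?leqnn.
rewrite !mulmx_sumr (le_trans (ler_enorm_sum _ _))// ler_sum// => j /andP[mj jk].
by rewrite (le_trans (Hk _ _ _)) ?(leqW mj)// enorm_delta.
Qed.

End Projection.

(** * Expectation bounds from second moments *)

Section MomentBound.
Context {R : realType} {d : measure_display} {Omega : measurableType d}.
Variables (P : probability Omega R) (I : finType) (a : I -> Omega -> R[i]).

(* Since [E |a j|^2 = 1], the expectation of the affine majorant is
   [c0 + \sum_j b j]; [F] itself need not be known to be measurable. *)
Definition moment_bounded (F : Omega -> R) (c : R) : Prop :=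
  exists c0 (b : I -> R), [/\ 0 <= c0, forall j, 0 <= b j,
    c0 + \sum_j b j <= c &
    forall w, F w <= c0 + \sum_j b j * Normc.normc (a j w) ^+ 2].

Lemma moment_bounded_le F G c e : (forall w, F w <= G w) -> c <= e ->
  moment_bounded G c -> moment_bounded F e.
Proof.
move=> FG ce [c0 [b [c00 b0 bc Gb]]]; exists c0, b; split=> //.
  exact: le_trans ce.
by move=> w; exact: le_trans (FG w) (Gb w).
Qed.

Lemma moment_bounded0 : moment_bounded (fun=> 0) 0.
Proof.
by exists 0, (fun=> 0); split=> // [|w]; rewrite add0r big1// => j _; rewrite mul0r.
Qed.

Lemma moment_boundedD F G c e : moment_bounded F c -> moment_bounded G e ->
  moment_bounded (fun w => F w + G w) (c + e).
Proof.
move=> [c0 [b [c00 b0 bc Fb]]] [e0 [b' [e00 b'0 b'e Gb]]].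
exists (c0 + e0), (fun j => b j + b' j); split=> [|j||w].
- exact: addr_ge0.
- exact: addr_ge0.
- by rewrite big_split addrACA lerD.
- under eq_bigr do rewrite mulrDl.
  by rewrite big_split addrACA lerD.
Qed.

Lemma moment_boundedZ F c k : 0 <= k -> moment_bounded F c ->
  moment_bounded (fun w => k * F w) (k * c).
Proof.
move=> k0 [c0 [b [c00 b0 bc Fb]]].
exists (k * c0), (fun j => k * b j); split=> [|j||w].
- exact: mulr_ge0.
- exact: mulr_ge0.
- by rewrite -mulr_sumr -mulrDr ler_wpM2l.
- under eq_bigr do rewrite -mulrA.
  by rewrite -mulr_sumr -mulrDr ler_wpM2l.
Qed.

Lemma moment_bounded_sum (J : finType) (p : pred J) F c :
  (forall j, p j -> moment_bounded (F j) (c j)) ->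
  moment_bounded (fun w => \sum_(j | p j) F j w) (\sum_(j | p j) c j).
Proof.
move=> FJ.
suff: moment_bounded (\sum_(j | p j) F j) (\sum_(j | p j) c j).
  by apply: moment_bounded_le => // w; rewrite fct_sumE.
elim/big_ind2: _ => // [|F1 c1 F2 c2]; last exact: moment_boundedD.
exact: moment_bounded0.
Qed.

(* [sqrt q <= q / (2 sqrt e) + sqrt e / 2], an equality when [q = e]. *)
Lemma moment_bounded_sqrt (p : I -> R) : (forall j, 0 <= p j) ->
  moment_bounded (fun w => Num.sqrt (\sum_j p j * Normc.normc (a j w) ^+ 2))
                 (Num.sqrt (\sum_j p j)).
Proof.
move=> p0; set e := \sum_j p j; have e0 : 0 <= e by rewrite sumr_ge0.
(* The majorant divides by [Num.sqrt e]; if [e] vanishes, so does every [p j]. *)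
have [e_eq0|e_neq0] := eqVneq e 0.
  apply: moment_bounded_le moment_bounded0 => [w|]; last exact: sqrtr_ge0.
  rewrite big1 ?sqrtr0// => j _; suff -> : p j = 0 by rewrite mul0r.
  by apply/eqP; move/eqP: e_eq0; rewrite psumr_eq0// => /allP; apply; rewrite mem_index_enum.
have r0 : 0 < Num.sqrt e by rewrite sqrtr_gt0 lt_neqAle eq_sym e_neq0.
exists (Num.sqrt e / 2), (fun j => (2 * Num.sqrt e)^-1 * p j); split.
- by rewrite divr_ge0 ?ltW.
- by move=> j; rewrite mulr_ge0// invr_ge0 mulr_ge0 ?ltW.
- rewrite -mulr_sumr -/e -[X in _^-1 * X](sqr_sqrtr e0).
  by rewrite le_eqVlt; apply/orP; left; apply/eqP; field; rewrite gt_eqF.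
- move=> w; under [X in _ + X]eq_bigr do rewrite -mulrA.
  rewrite -mulr_sumr; set q := \sum_j _.
  have q0 : 0 <= q by rewrite sumr_ge0// => j _; rewrite mulr_ge0 ?sqr_ge0.
  rewrite -{2}[q]sqr_sqrtr// -subr_ge0.
  have -> : Num.sqrt e / 2 + (2 * Num.sqrt e)^-1 * Num.sqrt q ^+ 2 - Num.sqrt q
     = (2 * Num.sqrt e)^-1 * (Num.sqrt e - Num.sqrt q) ^+ 2.
    by field; rewrite gt_eqF.
  by rewrite mulr_ge0 ?sqr_ge0// invr_ge0 mulr_ge0 ?ltW.
Qed.

(** The square-root bound with all the weight on index [j]. *)
Lemma moment_bounded_normc j : moment_bounded (fun w => Normc.normc (a j w)) 1.
Proof.
apply: moment_bounded_le (moment_bounded_sqrt (p := fun i => (i == j)%:R) _).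
- move=> w; rewrite (bigD1 j)//= eqxx mul1r big1 ?addr0 => [|i /negbTE->]; last by rewrite mul0r.
  by rewrite sqrtr_sqr ger0_norm ?normc_ge0.
- by rewrite (bigD1 j)//= eqxx big1 ?addr0 ?sqrtr1// => i /negbTE->.
- by move=> i; rewrite ler0n.
Qed.

Lemma measurable_sqr_normc (X : Omega -> R[i]) :
  measurable_fun setT (fun w => complex.Re (X w)) ->
  measurable_fun setT (fun w => complex.Im (X w)) ->
  measurable_fun setT (fun w => Normc.normc (X w) ^+ 2).
Proof.
move=> mRe mIm; rewrite (_ : (fun w => _) =
    (fun w => complex.Re (X w) ^+ 2 + complex.Im (X w) ^+ 2)).
  by apply: measurable_funD; apply: measurable_funX.
apply/funext => w; case: (X w) => x y /=.
by rewrite sqr_sqrtr// addr_ge0 ?sqr_ge0.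
Qed.

(** The integral of a nonnegative function is a supremum over the simple functions below it, so it
    is monotone without any measurability. *)
Lemma ge0_le_expectation (F G : Omega -> R) :
  (forall w, 0 <= F w) -> (forall w, F w <= G w) -> ('E_P[F] <= 'E_P[G])%E.
Proof.
move=> F0 FG; rewrite unlock.
have G0 w : 0 <= G w by exact: le_trans (F0 w) (FG w).
rewrite !ge0_integralTE => [|w|w]; rewrite ?lee_fin//.
apply: ereal_sup_le => /= _ [h hF <-]; exists h => // w.
by rewrite (le_trans (hF w))// lee_fin.
Qed.

Lemma moment_bounded_expectation (F : Omega -> R) c :
  (forall j, zero_mean_unit_variance P (a j)) -> (forall w, 0 <= F w) ->
  moment_bounded F c -> ('E_P[F] <= c%:E)%E.
Proof.
move=> ha F0 [c0 [b [c00 b0 bc Fb]]].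
apply: (le_trans (ge0_le_expectation F0 Fb)).
have msq j : measurable_fun setT (fun w => Normc.normc (a j w) ^+ 2).
  by have [mRe mIm _ _] := ha j; exact: measurable_sqr_normc.
(* With zero mean, the variance is the second moment. *)
have sq j : (\int[P]_w (Normc.normc (a j w) ^+ 2)%:E = 1)%E.
  have [_ _ m0 <-] := ha j; rewrite /cvariance unlock m0.
  by apply: eq_integral => w _; rewrite subr0.
rewrite unlock; under eq_integral do rewrite EFinD -sumEFin.
rewrite ge0_integralD//=; last first.
- apply: emeasurable_sum => j; apply/measurable_EFinP.
  exact: measurable_funM.
- by move=> w _; rewrite sume_ge0// => j _; rewrite lee_fin mulr_ge0 ?sqr_ge0.
rewrite integral_cst//= probability_setT mule1 ge0_integral_sum//; last first.
- by move=> j w _; rewrite lee_fin mulr_ge0 ?sqr_ge0.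
- by move=> j; apply/measurable_EFinP; exact: measurable_funM.
rewrite (eq_bigr (fun j => (b j)%:E)) => [|j _].
  by rewrite sumEFin -EFinD lee_fin.
under eq_integral do rewrite EFinM.
rewrite ge0_integralZl_EFin//; first by rewrite sq mule1.
- by move=> w _; rewrite lee_fin sqr_ge0.
- exact/measurable_EFinP.
Qed.

End MomentBound.

(** * The contrast source in coordinates and the final estimate *)

Section Assembly.
Context {R : realType} {N : nat}.

Lemma tail_sumE (s : nat -> R) k :
  tail_sum N s k = \sum_(j < N) (k <= j)%N%:R * s j.+1.
Proof.
rewrite /tail_sum big_add1 /= big_geq_mkord big_mkcond /=.
by apply: eq_bigr => j _; case: ifP; rewrite ?mul1r ?mul0r.
Qed.

Context {Omega : Type} (a : 'I_N -> Omega -> R[i]) (lam : nat -> R).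
Implicit Types U : 'M[R[i]]_N.

(** Coordinates of the contrast source in the basis of the columns of [U]. *)
Definition coef (w : Omega) : 'cV[R[i]]_N :=
  \col_j (a j w * (Num.sqrt (lam j.+1))%:C).

Lemma contrast_truncE U k w : contrast_trunc a lam U k w = U *m (lo_mx k *m coef w).
Proof.
apply/colP => i; rewrite summxE mxE big_mkcond /=; apply: eq_bigr => j _.
by rewrite lo_mxE; case: ifP; rewrite ?mulr0// !mxE mulrC.
Qed.

Lemma contrastE U w : contrast a lam U w = U *m coef w.
Proof.
by apply/colP => i; rewrite summxE mxE; apply: eq_bigr => j _; rewrite !mxE mulrC.
Qed.

Lemma normc_coef j w :
  Normc.normc (coef w j 0) = Num.sqrt (lam j.+1) * Normc.normc (a j w).
Proof. by rewrite mxE Normc.normcM normc_real ger0_norm ?sqrtr_ge0// mulrC. Qed.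

(** The weighted form required by [moment_bounded_sqrt]; the weights add up to
    [tail_sum N lam k]. *)
Lemma enorm_hi_coef k w : (forall j : 'I_N, 0 <= lam j.+1) ->
  enorm (hi_mx k *m coef w) =
  Num.sqrt (\sum_(j < N) ((k <= j)%N%:R * lam j.+1) * Normc.normc (a j w) ^+ 2).
Proof.
move=> lam0; rewrite /enorm; congr Num.sqrt; apply: eq_bigr => j _.
rewrite hi_mxE; case: ifP => _; last by rewrite Normc.normc0 expr0n !mul0r.
by rewrite normc_coef exprMn sqr_sqrtr// mul1r.
Qed.

End Assembly.

(** Applied with [l], [l'] consecutive singular values, [m] the value at [K] and [c] the
    perturbation norm. The ratio gives [l - l' >= l * (L - 1) / L], and [c <= m <= sqrt m * sqrt l]
    cancels the remaining [l]. *)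
Lemma relative_gap_bound {R : realType} (L l l' m c : R) :
  1 < L -> 0 < m -> m <= l -> 0 <= l' -> (L%:E < eratio l l')%E ->
  0 <= c <= m ->
  2 * c / (l - l') * Num.sqrt l <= 2 * L / (L - 1) * Num.sqrt m.
Proof.
move=> L1 m0 ml l'0 ratio /andP[c0 cm].
have l0 : 0 < l := lt_le_trans m0 ml.
have gap : L * l' <= l.
  move: ratio; rewrite /eratio; case: eqVneq => [->|l'n0]; first by rewrite mulr0 ltW.
  have l'p : 0 < l' by rewrite lt_neqAle eq_sym l'n0.
  by rewrite lte_fin ltr_pdivlMr// => /ltW.
have gap_gt0 : 0 < l - l' by nra.
have sm0 : 0 < Num.sqrt m by rewrite sqrtr_gt0.
have sml : Num.sqrt m <= Num.sqrt l by rewrite ler_wsqrtr.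
have c_sqrt : c <= Num.sqrt m * Num.sqrt l.
  by rewrite (le_trans cm)// -[leLHS](sqr_sqrtr (ltW m0)) expr2 ler_pM2l.
have gapL : (L - 1) * l <= L * (l - l') by lra.
have -> : 2 * c / (l - l') * Num.sqrt l = 2 * (c * Num.sqrt l) / (l - l').
  by field; rewrite gt_eqF.
have -> : 2 * L / (L - 1) * Num.sqrt m = 2 * (L * Num.sqrt m) / (L - 1).
  by field; rewrite gt_eqF ?subr_gt0.
rewrite ler_pdivrMr// mulrAC ler_pdivlMr ?subr_gt0//.
rewrite -!mulrA ler_pM2l//.
apply: (@le_trans _ _ (Num.sqrt m * ((L - 1) * l))); last first.
  by rewrite mulrCA ler_pM2l.
have -> : Num.sqrt m * ((L - 1) * l) = Num.sqrt m * Num.sqrt l * (Num.sqrt l * (L - 1)).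
  by rewrite -[in LHS](sqr_sqrtr (ltW l0)); ring.
by rewrite ler_wpM2r// mulr_ge0 ?sqrtr_ge0// subr_ge0 ltW.
Qed.

Theorem theorem5p4 (R : realType) (N : nat) (C Cd : 'M[R[i]]_N)
    (U V Ut Vt : 'M[R[i]]_N) (lam lamt : nat -> R)
    (d : measure_display) (Omega : measurableType d) (P : probability Omega R)
    (a : 'I_N -> Omega -> R[i]) (T : nat) (L : R) (K : nat) :
  hermitian_psd C ->
  is_svd C U lam V ->
  (forall i, (1 <= i < N)%N -> lam i.+1 < lam i) ->
  Cd \is hermsymmx ->
  is_svd (C + Cd) Ut lamt Vt ->
  (forall n, zero_mean_unit_variance P (a n)) ->
  (1 <= T)%N ->
  1 < L ->
  (forall i, (T < i < N)%N -> (L%:E < eratio (lam i) (lam i.+1))%E) ->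
  (T < K < N)%N ->
  spectral_norm Cd < lam K ->
  let eps := tail_sum N lam in
  let C1 := 2 * Num.sqrt (eps 0%N) / (lam T - lam T.+1) in
  let C2 := 2 * L / (L - 1) in
  ('E_P[fun w => enorm (contrast_trunc a lam U K w
                        - contrast_proj a lam U Ut K w)]
    <= (Num.sqrt (eps K) + C1 * lam K + C2 * K%:R * Num.sqrt (lam K))%:E)%E.
Proof.
move=> _ svdC decr Cdh svdCt ha T1 L1 ratio /andP[TK KN] Cd_lt.
lazy zeta; set eps := tail_sum N lam; set C1 := 2 * Num.sqrt _ / _; set C2 := 2 * L / _.
have [Uu Vu lam0 _ _] := svdC; have [Utu Vtu _ _ _] := svdCt.
set c := spectral_norm Cd in Cd_lt.
have c0 : 0 <= c by exact: spectral_norm_ge0.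
have lamK0 : 0 < lam K by rewrite (le_lt_trans c0).
(* Since the perturbation is Hermitian, one constant serves both one-sided hypotheses of [wedin]. *)
have Cd_adj : Cd ^t* = Cd.
  by have /is_hermitianmxP herm := Cdh; rewrite [RHS]herm expr0 scale1r.
pose g k := 2 * c / (lam k - lam k.+1).
have gap k : (T <= k <= K)%N -> 0 < lam k - lam k.+1.
  move=> /andP[Tk kK]; rewrite subr_gt0 decr// (leq_trans T1 Tk).
  by rewrite (leq_ltn_trans kK KN).
have g0 k : (T <= k <= K)%N -> 0 <= g k.
  by move=> /gap gk; rewrite divr_ge0 ?mulr_ge0// ltW.
have sinTheta k : (T <= k <= K)%N -> forall x,
    enorm (hi_mx k *m (Ut ^t* *m (U *m (lo_mx k *m x)))) <= g k * enorm x.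
  move=> /[dup] TkK /andP[Tk kK].
  have eCd : C + Cd - C = Cd by rewrite addrC addKr.
  apply: (wedin svdC svdCt) => //.
  - by rewrite (leq_trans T1 Tk) (leq_ltn_trans kK KN).
  - by rewrite -subr_gt0 gap.
  - by move=> x; rewrite eCd le_spectral_norm.
  - by move=> x; rewrite eCd Cd_adj le_spectral_norm.
have hi_bound k : moment_bounded a (fun w => enorm (hi_mx k *m coef a lam w))
    (Num.sqrt (eps k)).
  rewrite /eps tail_sumE.
  apply: moment_bounded_le (moment_bounded_sqrt a (p := fun j => (k <= j)%N%:R * lam j.+1) _)
    => [w|//|j].
    by rewrite enorm_hi_coef.
  by rewrite mulr_ge0 ?ler0n.
apply: (moment_bounded_expectation ha) => [w|]; first exact: enorm_ge0.
(* The three terms yield the three terms of the bound. The full norm is written with [hi_mx 0], the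
   identity, so that [hi_bound] gives [sqrt (eps 0)]. *)
pose F w := enorm (hi_mx K *m coef a lam w) + g T * enorm (hi_mx 0 *m coef a lam w)
  + \sum_(j < N | (T <= j < K)%N)
      g j.+1 * (Num.sqrt (lam j.+1) * Normc.normc (a j w)).
apply: (@moment_bounded_le _ _ _ _ _ _ F
  (Num.sqrt (eps K) + g T * Num.sqrt (eps 0%N) +
   \sum_(j < N | (T <= j < K)%N) g j.+1 * (Num.sqrt (lam j.+1) * 1))).
- move=> w; rewrite contrast_truncE /contrast_proj contrastE.
  have -> : U *m coef a lam w = Ut *m (Ut ^t* *m (U *m coef a lam w)).
    by rewrite (mulmxA Ut) (unitarymxP Utu) mul1mx.
  rewrite orth_proj_lead_span//.
  rewrite (le_trans (trunc_sub_proj_le _ Uu Utu (ltnW TK) (g0 T _) sinTheta))//.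
    by rewrite leqnn ltnW.
  rewrite /F; have -> : hi_mx 0 *m coef a lam w = coef a lam w.
    by apply/colP => j; rewrite hi_mxE.
  by rewrite lerD2l; apply: ler_sum => j _; rewrite normc_coef.
- have gT : g T * Num.sqrt (eps 0%N) <= C1 * lam K.
    have gapT : 0 <= (lam T - lam T.+1)^-1.
      by rewrite invr_ge0 ltW// gap// leqnn ltnW.
    rewrite /g /C1 mulrAC [leRHS]mulrAC ler_wpM2r//.
    by rewrite mulrAC ler_wpM2l ?mulr_ge0 ?sqrtr_ge0// ltW.
  rewrite lerD ?lerD2l//.
  have C20 : 0 <= C2.
    by rewrite /C2 divr_ge0 ?subr_ge0 ?mulr_ge0 ?(ltW L1)// ltW// (lt_trans _ L1).
  (* Only the directions with [T <= j] occur on the left; the [T] missing ones are filled up with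
     nonnegative terms to reach the factor [K]. *)
  have -> : C2 * K%:R * Num.sqrt (lam K) = \sum_(j < N | (j < K)%N) C2 * Num.sqrt (lam K).
    rewrite -(big_ord_widen _ (fun=> C2 * Num.sqrt (lam K)) (ltnW KN)).
    by rewrite sumr_const card_ord mulrAC mulr_natr.
  rewrite big_mkcondl; apply: ler_sum => j jK.
  case: ifP => [Tj|_]; last by rewrite mulr_ge0 ?sqrtr_ge0.
  have jN : (j.+1 < N)%N := leq_ltn_trans jK KN.
  rewrite mulr1; apply: relative_gap_bound => //.
  + by rewrite (svd_lead_le svdC)// jK ltnW.
  + exact: (svd_ge0 svdC).
  (* The zero-based [j >= T] stands for the singular value of index [j.+1 > T], where the decay
     hypothesis applies. *)
  + by apply: ratio; rewrite ltnS Tj.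
  + by rewrite c0 ltW.
- apply: moment_boundedD; first apply: moment_boundedD.
  + by apply: hi_bound.
  + by apply: moment_boundedZ; [apply: g0; rewrite leqnn ltnW | exact: hi_bound].
  + apply: moment_bounded_sum => j jTK; apply: moment_boundedZ.
      by apply: g0; case/andP: jTK => Tj jK; rewrite (leqW Tj).
    apply: moment_boundedZ; first exact: sqrtr_ge0.
    exact: moment_bounded_normc.
Qed.
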